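(* Let $G$ act properly, isometrically and non-elementarily on a proper geodesic hyperbolic space $X$, and fix $o\in X$. Let $h,k\in G$ be loxodromic, let $H=E(h)$, $K=E(k)$, and let $\alpha,\beta\subset X$ be quasi-geodesics preserved cocompactly by $H$ and $K$ respectively. For $n,\Delta>0$ let $\mathrm{Arc}(n,\Delta)$ denote the set of $G$-orbits (under the diagonal action) of pairs $(g_1\alpha,g_2\beta)$, $g_1,g_2\in G$, with $|d(g_1\alpha,g_2\beta)-n|\le\Delta$, and let $A(o,n,\Delta)=\{go\in Go: |d(o,go)-n|\le\Delta\}$. Then for every $\Delta>0$ there exist $\Delta'=\Delta'(\Delta,o)$ and $c=c(\Delta,o)>0$ such that for all sufficiently large $n$, $$|\mathrm{Arc}(n,\Delta')|\ge c\,|A(o,n,\Delta)|.$$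
   Context: $E(h)$ is the maximal elementary (virtually cyclic) subgroup of $G$ containing a loxodromic element $h$. $d(A,B)=\inf_{a\in A,b\in B}d(a,b)$. Non-elementary: the limit set (accumulation points of $Go$ in $\partial X$) has at least three points. *)

(* Defs.v *)
From Stdlib Require Import Reals Lra List ZArith.
From Coquelicot Require Import Coquelicot.
Open Scope R_scope.
Set Implicit Arguments.
Unset Strict Implicit.

Section Defs.
Variables (X : Type) (d : X -> X -> R).
Variables (G : Type) (mul : G -> G -> G) (one : G) (inv : G -> G).
Variable act : G -> X -> X.

Definition is_metric : Prop :=
  (forall x y, d x y = 0 <-> x = y) /\
  (forall x y, d x y = d y x) /\
  (forall x y z, d x z <= d x y + d y z).

Definition seq_cv (u : nat -> X) (y : X) : Prop :=
  forall eps, 0 < eps -> exists N, forall n, (N <= n)%nat -> d (u n) y < eps.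

Definition seq_compact (C : X -> Prop) : Prop :=
  forall u : nat -> X, (forall n, C (u n)) ->
  exists (phi : nat -> nat) (y : X),
    (forall n, (phi n < phi (S n))%nat) /\ C y /\ seq_cv (fun n => u (phi n)) y.

Definition proper_space : Prop :=
  forall x r, seq_compact (fun y => d x y <= r).

Definition geodesic_space : Prop :=
  forall x y, exists gam : R -> X,
    gam 0 = x /\ gam (d x y) = y /\
    forall s t, 0 <= s <= d x y -> 0 <= t <= d x y ->
      d (gam s) (gam t) = Rabs (s - t).

Definition gromov (w x y : X) : R := (d w x + d w y - d x y) / 2.

Definition hyperbolic : Prop :=
  exists delta, 0 <= delta /\
    forall w x y z, gromov w x z >= Rmin (gromov w x y) (gromov w y z) - delta.

Definition is_group : Prop :=
  (forall a b c, mul a (mul b c) = mul (mul a b) c) /\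
  (forall a, mul one a = a) /\ (forall a, mul a one = a) /\
  (forall a, mul (inv a) a = one) /\ (forall a, mul a (inv a) = one).

Definition isometric_action : Prop :=
  (forall x, act one x = x) /\
  (forall g g' x, act (mul g g') x = act g (act g' x)) /\
  (forall g x y, d (act g x) (act g y) = d x y).

Definition finite_pred {T : Type} (P : T -> Prop) : Prop :=
  exists l : list T, forall t, P t -> In t l.

Definition proper_action : Prop :=
  forall x r, finite_pred (fun g => d x (act g x) <= r).

Fixpoint powN (g : G) (n : nat) : G :=
  match n with O => one | S m => mul g (powN g m) end.
Definition powZ (g : G) (z : Z) : G :=
  match z with
  | Z0 => one
  | Zpos p => powN g (Pos.to_nat p)
  | Zneg p => inv (powN g (Pos.to_nat p))
  end.

Definition loxodromic (o : X) (g : G) : Prop :=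
  exists lam c, 1 <= lam /\ 0 <= c /\
    forall m n : Z,
      / lam * Rabs (IZR m - IZR n) - c <= d (act (powZ g m) o) (act (powZ g n) o) /\
      d (act (powZ g m) o) (act (powZ g n) o) <= lam * Rabs (IZR m - IZR n) + c.

Definition cv_infinity (o : X) (u : nat -> X) : Prop :=
  forall M, exists N, forall i j, (N <= i)%nat -> (N <= j)%nat -> gromov o (u i) (u j) >= M.
Definition equiv_infinity (o : X) (u v : nat -> X) : Prop :=
  forall M, exists N, forall i j, (N <= i)%nat -> (N <= j)%nat -> gromov o (u i) (v j) >= M.
Definition in_orbit_seq (o : X) (u : nat -> X) : Prop :=
  forall n, exists g, u n = act g o.

(** Non-elementary: the limit set of Go has at least three points. *)
Definition non_elementary (o : X) : Prop :=
  exists u1 u2 u3 : nat -> X,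
    in_orbit_seq o u1 /\ in_orbit_seq o u2 /\ in_orbit_seq o u3 /\
    cv_infinity o u1 /\ cv_infinity o u2 /\ cv_infinity o u3 /\
    ~ equiv_infinity o u1 u2 /\ ~ equiv_infinity o u1 u3 /\ ~ equiv_infinity o u2 u3.

Definition subgroup (H : G -> Prop) : Prop :=
  H one /\ (forall a b, H a -> H b -> H (mul a b)) /\ (forall a, H a -> H (inv a)).
Definition virtually_cyclic (H : G -> Prop) : Prop :=
  subgroup H /\ exists z, H z /\ exists l : list G, List.Forall H l /\
    forall x, H x -> exists y k, In y l /\ x = mul y (powZ z k).
Definition is_max_elementary (h : G) (H : G -> Prop) : Prop :=
  H h /\ virtually_cyclic H /\
  forall H', virtually_cyclic H' -> H' h -> forall x, H' x -> H x.

Definition quasi_geodesic (A : X -> Prop) : Prop :=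
  exists (gam : R -> X) lam c, 1 <= lam /\ 0 <= c /\
    (forall s t, / lam * Rabs (s - t) - c <= d (gam s) (gam t) /\
                 d (gam s) (gam t) <= lam * Rabs (s - t) + c) /\
    (forall x, A x <-> exists t, x = gam t).

Definition translate (g : G) (A : X -> Prop) : X -> Prop :=
  fun x => exists y, A y /\ x = act g y.
Definition set_eq (A B : X -> Prop) : Prop := forall x, A x <-> B x.

Definition preserves (H : G -> Prop) (A : X -> Prop) : Prop :=
  forall g, H g -> set_eq (translate g A) A.

Definition cocompact (H : G -> Prop) (A : X -> Prop) : Prop :=
  exists C, seq_compact C /\ forall x, A x -> exists g c, H g /\ C c /\ x = act g c.

Definition setdist (A B : X -> Prop) : Rbar :=
  Glb_Rbar (fun r => exists a b, A a /\ B b /\ r = d a b).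

Definition within_of (D : Rbar) (n Delta : R) : Prop :=
  Rbar_le (Finite (n - Delta)) D /\ Rbar_le D (Finite (n + Delta)).

Definition annulus (o : X) (n Delta : R) : X -> Prop :=
  fun x => (exists g, x = act g o) /\ Rabs (d o x - n) <= Delta.

Definition arc_rep (alpha beta : X -> Prop) (n Delta : R) : G * G -> Prop :=
  fun p => within_of (setdist (translate (fst p) alpha) (translate (snd p) beta)) n Delta.

Definition same_orbit (alpha beta : X -> Prop) (p q : G * G) : Prop :=
  exists g, set_eq (translate g (translate (fst p) alpha)) (translate (fst q) alpha) /\
            set_eq (translate g (translate (snd p) beta)) (translate (snd q) beta).
End Defs.

(** "The set of R-classes of elements satisfying P has at least m elements". *)
Definition card_ge {T : Type} (P : T -> Prop) (R : T -> T -> Prop) (m : nat) : Prop :=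
  exists l : list T, length l = m /\ List.Forall P l /\ ForallOrdPairs (fun a b => ~ R a b) l.

(** |S1| >= c |S2| for possibly infinite cardinalities (counted up to the given relations). *)
Definition card_ge_scaled {T U : Type} (P1 : T -> Prop) (R1 : T -> T -> Prop)
    (c : R) (P2 : U -> Prop) (R2 : U -> U -> Prop) : Prop :=
  forall m, card_ge P2 R2 m -> exists m', card_ge P1 R1 m' /\ c * INR m <= INR m'.

(* Main.v *)
(** The orbit of [o] under a suitable power of a loxodromic element is a "straight" bi-infinite
    sequence: all interior Gromov products are bounded.  If every translate of this axis shared an
    endpoint with it, every [g] would conjugate some power of the element to a power, so that all
    of [G o] would stay near the axis, against non-elementarity.  Hence some translate [f alpha] is
    transverse to [alpha], and for each [g] the point [g o] has bounded Gromov product at [o] with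
    one of [alpha], [f alpha].  Doing this at both ends of [o, g o] gives a pair of translates whose
    distance is [d(o, g o)] up to a constant and whose nearly shortest connections start near [o]
    and end near [g o].  By properness, boundedly many points [g o] give pairs in one orbit. *)
Require Import Defs.
From Stdlib Require Import Reals List ZArith Lra Lia Classical ClassicalEpsilon IndefiniteDescription.
From Coquelicot Require Import Coquelicot.
Open Scope R_scope.

(** * Counting *)

(** Induction on the list of colours: a colour that occurs at most once from [N] on is discarded by
    starting after its occurrence. *)
Lemma infinite_pigeonhole (T : Type) (R : nat -> T -> Prop) (l : list T) (N : nat) :
  (forall n, (N <= n)%nat -> exists t, In t l /\ R n t) ->
  exists n n' t, (n < n')%nat /\ R n t /\ R n' t.
Proof.
  revert N; induction l as [|a l IH]; intros N HN.
  - destruct (HN N (le_n _)) as [t [[] _]].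
  - destruct (classic (exists n n', (N <= n)%nat /\ (n < n')%nat /\ R n a /\ R n' a))
      as [(n & n' & _ & Hlt & H1 & H2)|Hno]; [now exists n, n', a|].
    destruct (classic (exists n, (N <= n)%nat /\ R n a)) as [(n0 & Hn0 & Ha0)|Hno'].
    + apply (IH (S n0)); intros n Hn.
      destruct (HN n ltac:(lia)) as [t [[<-|Ht] HR]]; [|now exists t].
      exfalso; apply Hno; exists n0, n; repeat split; auto; lia.
    + apply (IH N); intros n Hn.
      destruct (HN n Hn) as [t [[<-|Ht] HR]]; [|now exists t].
      exfalso; apply Hno'; now exists n.
Qed.

Lemma list_upper_bound (T : Type) (f : T -> R) (l : list T) :
  exists B, 0 <= B /\ forall t, In t l -> f t <= B.
Proof.
  induction l as [|a l (B & HB0 & HB)].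
  - exists 0; split; [lra|intros t []].
  - exists (Rmax B (f a)); split; [eapply Rle_trans; [exact HB0|apply Rmax_l]|].
    intros t [<-|Ht]; [apply Rmax_r|eapply Rle_trans; [now apply HB|apply Rmax_l]].
Qed.

Lemma filter_not_in_length (T : Type) (eq_dec : forall x y : T, {x = y} + {x <> y}) (b l : list T) :
  NoDup l ->
  (length l <= length b + length (filter (fun x => if in_dec eq_dec x b then false else true) l))%nat.
Proof.
  intros Hl.
  set (p := fun x => if in_dec eq_dec x b then true else false).
  assert (Hin : (length (filter p l) <= length b)%nat).
  { apply NoDup_incl_length; [now apply NoDup_filter|].
    intros x Hx; apply filter_In in Hx as [_ Hx]; unfold p in Hx.
    now destruct (in_dec eq_dec x b). }
  pose proof (filter_length p l) as Hlen.
  rewrite (filter_ext _ (fun x => negb (p x))).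
  2: intros x; unfold p; now destruct (in_dec eq_dec x b).
  lia.
Qed.

(** Greedy selection: keeping the head removes at most [M] later elements related to it, so each
    kept element accounts for at most [M + 1] entries of [l]. *)
Lemma sparse_sublist (T : Type) (P : T -> Prop) (R : T -> T -> Prop) (M : nat) :
  (forall x, P x -> exists b, (length b <= M)%nat /\ forall y, P y -> R x y -> In y b) ->
  forall l, NoDup l -> List.Forall P l ->
  exists l', incl l' l /\ ForallOrdPairs (fun x y => ~ R x y) l' /\
    (length l <= (M + 1) * length l')%nat.
Proof.
  intros HR l; remember (length l) as n eqn:Hn; assert (Hle : (length l <= n)%nat) by lia.
  rewrite Hn; clear Hn; revert l Hle.
  induction n as [|n IH]; intros [|x l] Hle Hnd HP;
    try (exists nil; repeat split; [intros ? []|constructor|simpl; lia]).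
  - simpl in Hle; lia.
  - set (eq_dec := fun a c : T => excluded_middle_informative (a = c)).
    inversion_clear Hnd as [|? ? Hx Hl]; inversion_clear HP as [|? ? Px Pl].
    destruct (HR x Px) as (b & Hb & HbR).
    pose proof (filter_not_in_length T eq_dec b l Hl) as Hlen.
    set (p := fun y => if in_dec eq_dec y b then false else true) in *.
    rewrite Forall_forall in Pl.
    pose proof (filter_length_le p l) as Hfl; simpl in Hle.
    destruct (IH (filter p l)) as (l' & Hincl & Hpairs & Hlen').
    + lia.
    + now apply NoDup_filter.
    + apply Forall_forall; intros y Hy; apply Pl; now apply filter_In in Hy.
    + exists (x :: l'); repeat split.
      * intros y [<-|Hy]; [now left|right; apply Hincl, filter_In in Hy; tauto].
      * constructor; [|exact Hpairs].
        apply Forall_forall; intros y Hy Hxy.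
        apply Hincl, filter_In in Hy as [Hyl Hpy].
        specialize (HbR y (Pl y Hyl) Hxy); unfold p in Hpy.
        now destruct (in_dec eq_dec y b).
      * simpl; lia.
Qed.

(** * Gromov products and powers *)

Section Hyperbolic_action.
Variables (X : Type) (d : X -> X -> R).
Variables (G : Type) (mul : G -> G -> G) (one : G) (inv : G -> G).
Variables (act : G -> X -> X) (o : X) (delta : R).
Hypothesis metric : is_metric d.
Hypothesis delta_ge0 : 0 <= delta.
Hypothesis delta_hyperbolic : forall w x y z,
  gromov d w x z >= Rmin (gromov d w x y) (gromov d w y z) - delta.
Hypothesis group : is_group mul one inv.
Hypothesis isometric : isometric_action d mul one act.
Hypothesis proper : proper_action d act.

Lemma dist_self x : d x x = 0.
Proof. now apply (proj1 metric). Qed.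

Lemma dist_sym x y : d x y = d y x.
Proof. apply metric. Qed.

Lemma dist_tri x y z : d x z <= d x y + d y z.
Proof. apply metric. Qed.

Lemma dist_ge0 x y : 0 <= d x y.
Proof.
  pose proof (dist_tri x y x); rewrite dist_self, (dist_sym y x) in H; lra.
Qed.

Lemma gromov_sym w x y : gromov d w x y = gromov d w y x.
Proof. unfold gromov; rewrite (dist_sym x y); lra. Qed.

Lemma gromov_le_left w x y : gromov d w x y <= d w x.
Proof. unfold gromov; pose proof (dist_tri w x y); lra. Qed.

Lemma gromov_le_right w x y : gromov d w x y <= d w y.
Proof. rewrite gromov_sym; apply gromov_le_left. Qed.

Lemma gromov_ge0 w x y : 0 <= gromov d w x y.
Proof.
  unfold gromov; pose proof (dist_tri x w y); rewrite (dist_sym x w) in H; lra.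
Qed.

Lemma gromov_move_left w x x' y : gromov d w x y <= gromov d w x' y + d x x'.
Proof.
  unfold gromov; pose proof (dist_tri w x' x); pose proof (dist_tri x' x y).
  rewrite (dist_sym x' x) in *; lra.
Qed.

Lemma gromov_base_swap w x y : gromov d w x y = d w x - gromov d x w y.
Proof. unfold gromov; rewrite (dist_sym x w); lra. Qed.

(** Hyperbolicity as a dichotomy; it is typically applied by showing that the left side of one
    alternative is too large. *)
Lemma gromov_ultra w x y z :
  gromov d w x y <= gromov d w x z + delta \/ gromov d w y z <= gromov d w x z + delta.
Proof.
  pose proof (delta_hyperbolic w x y z) as H; unfold Rmin in H.
  destruct (Rle_dec (gromov d w x y) (gromov d w y z)); [left|right]; lra.
Qed.

(** * Group and action identities, and integer powers *)

Lemma mulA a b c : mul a (mul b c) = mul (mul a b) c.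
Proof. apply group. Qed.

Lemma mul1 a : mul one a = a.
Proof. apply group. Qed.

Lemma mulr1 a : mul a one = a.
Proof. apply group. Qed.

Lemma mulV a : mul (inv a) a = one.
Proof. apply group. Qed.

Lemma mulVr a : mul a (inv a) = one.
Proof. apply group. Qed.

Lemma mulK a b : mul (inv a) (mul a b) = b.
Proof. now rewrite mulA, mulV, mul1. Qed.

Lemma mulVK a b : mul a (mul (inv a) b) = b.
Proof. now rewrite mulA, mulVr, mul1. Qed.

Lemma mul_inj a b c : mul a b = mul a c -> b = c.
Proof. intros H; rewrite <- (mulK a b), H; apply mulK. Qed.

Lemma invM a b : inv (mul a b) = mul (inv b) (inv a).
Proof.
  apply (mul_inj (mul a b)); rewrite mulVr, <- mulA, mulVK; now rewrite mulVr.
Qed.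

Lemma invK a : inv (inv a) = a.
Proof. apply (mul_inj (inv a)); now rewrite mulVr, mulV. Qed.

Lemma inv1 : inv one = one.
Proof. rewrite <- (mulr1 (inv one)); apply mulV. Qed.

Lemma act1 x : act one x = x.
Proof. apply isometric. Qed.

Lemma actM a b x : act (mul a b) x = act a (act b x).
Proof. apply isometric. Qed.

Lemma dist_act a x y : d (act a x) (act a y) = d x y.
Proof. apply isometric. Qed.

Lemma gromov_act a w x y : gromov d (act a w) (act a x) (act a y) = gromov d w x y.
Proof. unfold gromov; now rewrite !dist_act. Qed.

Lemma actK a x : act (inv a) (act a x) = x.
Proof. now rewrite <- actM, mulV, act1. Qed.

Lemma actVK a x : act a (act (inv a) x) = x.
Proof. now rewrite <- actM, mulVr, act1. Qed.

Lemma dist_act_inv a x y : d (act (inv a) x) y = d x (act a y).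
Proof. rewrite <- (dist_act a), actVK; reflexivity. Qed.

Lemma powN_add g m n : powN mul one g (m + n) = mul (powN mul one g m) (powN mul one g n).
Proof.
  induction m as [|m IH]; simpl; [now rewrite mul1|now rewrite IH, mulA].
Qed.

Lemma powZ_of_nat g n : powZ mul one inv g (Z.of_nat n) = powN mul one g n.
Proof.
  destruct n as [|n]; [reflexivity|simpl powZ].
  now rewrite SuccNat2Pos.id_succ.
Qed.

Lemma powZ_opp g n : powZ mul one inv g (- n) = inv (powZ mul one inv g n).
Proof. destruct n; simpl; [now rewrite inv1|reflexivity|now rewrite invK]. Qed.

Lemma powZ_succ g n : powZ mul one inv g (Z.succ n) = mul (powZ mul one inv g n) g.
Proof.
  destruct (Z.le_gt_cases 0 n) as [Hn|Hn].
  - rewrite <- (Z2Nat.id n Hn), <- Nat2Z.inj_succ, !powZ_of_nat, <- Nat.add_1_r, powN_add.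
    simpl; now rewrite mulr1.
  - replace n with (- Z.of_nat (S (Z.to_nat (- n - 1))))%Z by lia.
    replace (Z.succ (- Z.of_nat (S (Z.to_nat (- n - 1))))) with (- Z.of_nat (Z.to_nat (- n - 1)))%Z by lia.
    rewrite !powZ_opp, !powZ_of_nat; simpl.
    now rewrite invM, <- mulA, mulV, mulr1.
Qed.

Lemma powZ_add g m n :
  powZ mul one inv g (m + n) = mul (powZ mul one inv g m) (powZ mul one inv g n).
Proof.
  revert n; apply Z.peano_ind.
  - now rewrite Z.add_0_r, mulr1.
  - intros n IH; now rewrite Z.add_succ_r, !powZ_succ, IH, mulA.
  - intros n IH.
    rewrite <- (Z.succ_pred n), Z.add_succ_r, !powZ_succ, mulA in IH.
    apply (f_equal (fun x => mul x (inv g))) in IH.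
    rewrite <- mulA, mulVr, mulr1 in IH.
    now rewrite IH, <- !mulA, mulVr, mulr1.
Qed.

(** * Axes of loxodromic elements *)

(** Straightness is imposed at [o] only: as [e] is a homomorphism, translation carries it to every
    interior point of the orbit. The last clause makes the orbit escape at both ends. *)
Definition straight_axis (e : Z -> G) (s : R) : Prop :=
  (forall m n, e (m + n)%Z = mul (e m) (e n)) /\
  (forall m n, (0 <= m)%Z -> (0 <= n)%Z ->
     gromov d o (act (e (- m)%Z) o) (act (e n) o) <= s) /\
  (forall r, exists N, (0 <= N)%Z /\ forall n, (N <= Z.abs n)%Z -> r <= d o (act (e n) o)).

(** Otherwise each doubling of the index adds less than [B], so [a (2 ^ j)] grows at most linearly
    in [j], against the linear lower bound in [2 ^ j]. *)
Lemma exists_large_increment (a : nat -> R) lam c B :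
  0 < lam -> (forall n, INR n / lam - c <= a n) ->
  exists p, (0 < p)%nat /\ a p + B <= a (2 * p)%nat.
Proof.
  intros Hlam Ha; apply NNPP; intros Hno.
  assert (Hdbl : forall j, a (2 ^ j)%nat <= a 1%nat + INR j * Rabs B).
  { induction j as [|j IH]; [simpl; lra|].
    rewrite S_INR.
    destruct (Rle_lt_dec (a (2 ^ j)%nat + B) (a (2 * 2 ^ j)%nat)) as [H|H].
    - exfalso; apply Hno; exists (2 ^ j)%nat; split; [|exact H].
      pose proof (Nat.pow_nonzero 2 j); lia.
    - change (2 ^ S j)%nat with (2 * 2 ^ j)%nat.
      pose proof (Rle_abs B); lra. }
  assert (Hpow : forall j, (S j <= 2 ^ j)%nat).
  { induction j as [|j IH]; simpl; lia. }
  (* For [j > r] the chain [(j+1)^2 <= 2^(2j) <= lam * (a 1 + c + 2j|B|) < r (j+1) <= (j+1)^2] is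
     contradictory. *)
  set (r := lam * (Rabs (a 1%nat) + Rabs c + 2 * Rabs B + 1)).
  destruct (INR_unbounded r) as [j Hj].
  assert (Hsq : INR (S j) * INR (S j) <= INR (2 ^ (2 * j))).
  { replace (2 * j)%nat with (j + j)%nat by lia.
    rewrite Nat.pow_add_r, mult_INR; pose proof (le_INR _ _ (Hpow j)).
    pose proof (pos_INR (S j)); apply Rmult_le_compat; lra. }
  pose proof (Ha (2 ^ (2 * j))%nat) as H1; pose proof (Hdbl (2 * j)%nat) as H2.
  assert (H3 : INR (2 ^ (2 * j)) <= lam * (a 1%nat + c + INR (2 * j) * Rabs B)).
  { replace (INR (2 ^ (2 * j))) with (lam * (INR (2 ^ (2 * j)) / lam)) by (field; lra).
    apply Rmult_le_compat_l; lra. }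
  assert (H4 : r * INR (S j) <= INR (S j) * INR (S j)).
  { apply Rmult_le_compat_r; [apply pos_INR|rewrite S_INR; lra]. }
  assert (H5 : lam * (a 1%nat + c + INR (2 * j) * Rabs B) < r * INR (S j)).
  { unfold r; rewrite Rmult_assoc; apply Rmult_lt_compat_l; [exact Hlam|].
    rewrite S_INR, mult_INR; simpl (INR 2).
    pose proof (pos_INR j); pose proof (Rabs_pos (a 1%nat)); pose proof (Rabs_pos c).
    pose proof (Rabs_pos B); pose proof (Rle_abs (a 1%nat)); pose proof (Rle_abs c).
    assert (0 <= INR j * Rabs (a 1%nat)) by now apply Rmult_le_pos.
    assert (0 <= INR j * Rabs c) by now apply Rmult_le_pos.
    nra. }
  lra.
Qed.

(* A power [h^p] with [d(o, h^2p o) >= d(o, h^p o) + 4 delta + 1] moves [o] along a sequence with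
   small Gromov products at consecutive triples, and these propagate to all triples. *)
Lemma loxodromic_straight_axis h :
  loxodromic d mul one inv act o h ->
  exists p s, (0 < p)%Z /\ straight_axis (fun n => powZ mul one inv h (p * n)) s.
Proof.
  intros (lam & c & Hlam & Hc & Hqi).
  assert (Hgrow : forall n, IZR (Z.abs n) / lam - c <= d o (act (powZ mul one inv h n) o)).
  { intros n; destruct (Hqi n 0%Z) as [H _].
    change (powZ mul one inv h 0) with one in H.
    rewrite act1, dist_sym, Rminus_0_r, <- abs_IZR in H; lra. }
  destruct (exists_large_increment (fun n => d o (act (powZ mul one inv h (Z.of_nat n)) o))
    lam c (4 * delta + 1)) as (p & Hp & Hinc); [lra| |].
  { intros n; pose proof (Hgrow (Z.of_nat n)) as H.
    rewrite Z.abs_eq in H by lia.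
    now rewrite <- INR_IZR_INZ in H. }
  set (e := fun n => powZ mul one inv h (Z.of_nat p * n)).
  set (L := d o (act (e 1%Z) o)).
  set (s := gromov d (act (e 1%Z) o) o (act (e 2%Z) o)).
  assert (He : forall m n, e (m + n)%Z = mul (e m) (e n)).
  { intros m n; unfold e; now rewrite Z.mul_add_distr_l, powZ_add. }
  assert (He0 : act (e 0%Z) o = o) by (unfold e; rewrite Z.mul_0_r; apply act1).
  assert (Hshift : forall i j k l, gromov d (act (e (i + j)%Z) o) (act (e (i + k)%Z) o) (act (e (i + l)%Z) o)
    = gromov d (act (e j) o) (act (e k) o) (act (e l) o)).
  { intros; rewrite !He, !actM; apply gromov_act. }
  assert (Hd12 : d (act (e 1%Z) o) (act (e 2%Z) o) = L).
  { change 2%Z with (1 + 1)%Z; now rewrite He, actM, dist_act. }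
  assert (HLs : L - 2 * s >= 4 * delta + 1).
  { unfold s, gromov; rewrite Hd12, (dist_sym _ o); fold L.
    unfold e, L, e in *.
    replace (Z.of_nat (2 * p)) with (Z.of_nat p * 2)%Z in Hinc by lia.
    rewrite Z.mul_1_r; lra. }
  (* The other alternative bounds the product of the second and the last point at the first one. By
     the shifted induction hypothesis that product is at least [L - s - delta], so
     [L <= 2 * s + 2 * delta], against [HLs]. *)
  assert (Hfwd : forall n : nat,
    gromov d (act (e 1%Z) o) o (act (e (2 + Z.of_nat n)%Z) o) <= s + delta).
  { induction n as [|n IH]; [rewrite Z.add_0_r; fold s; lra|].
    destruct (gromov_ultra (act (e 1%Z) o) o (act (e (2 + Z.of_nat (S n))%Z) o) (act (e 2%Z) o))
      as [H|H]; [exact H|exfalso].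
    rewrite gromov_sym, gromov_base_swap, Hd12 in H.
    pose proof (Hshift 1%Z 1%Z 0%Z (2 + Z.of_nat n)%Z) as Hs.
    rewrite He0 in Hs.
    replace (1 + (2 + Z.of_nat n))%Z with (2 + Z.of_nat (S n))%Z in Hs by lia.
    change (1 + 1)%Z with 2%Z in Hs; change (1 + 0)%Z with 1%Z in Hs.
    rewrite Hs in H; fold s in H; lra. }
  assert (Hfwd' : forall n, (1 <= n)%Z ->
    gromov d o (act (e (-1)%Z) o) (act (e n) o) <= s + delta).
  { intros n Hn; specialize (Hfwd (Z.to_nat (n - 1))).
    pose proof (Hshift (-1)%Z 1%Z 0%Z (2 + Z.of_nat (Z.to_nat (n - 1)))%Z) as Hs.
    rewrite He0 in Hs.
    replace (-1 + (2 + Z.of_nat (Z.to_nat (n - 1))))%Z with n in Hs by lia.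
    change (-1 + 1)%Z with 0%Z in Hs; change (-1 + 0)%Z with (-1)%Z in Hs.
    rewrite He0 in Hs; lra. }
  exists (Z.of_nat p), (s + 2 * delta); split; [lia|]; split; [exact He|split].
  - change (forall m n, (0 <= m)%Z -> (0 <= n)%Z ->
      gromov d o (act (e (- m)%Z) o) (act (e n) o) <= s + 2 * delta).
    assert (Hs0 : 0 <= s) by apply gromov_ge0.
    (* The same argument, now extending backwards from [Hfwd']. The second loss of [delta] turns the
       excluded case into [L <= 2 * s + 4 * delta], whence the increment [4 * delta + 1]. *)
    assert (Hback : forall m n, (0 <= n)%Z ->
      gromov d o (act (e (- Z.of_nat m)%Z) o) (act (e n) o) <= s + 2 * delta).
    { induction m as [|m IH]; intros n Hn.
      { change (- Z.of_nat 0)%Z with 0%Z; rewrite He0.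
        pose proof (gromov_le_left o o (act (e n) o)) as H; rewrite dist_self in H; lra. }
      destruct (Z.eq_dec n 0) as [->|Hn0].
      { rewrite He0; pose proof (gromov_le_right o (act (e (- Z.of_nat (S m))%Z) o) o) as H.
        rewrite dist_self in H; lra. }
      pose proof (Hfwd' n ltac:(lia)) as Hn1.
      rewrite gromov_sym.
      destruct (gromov_ultra o (act (e n) o) (act (e (- Z.of_nat (S m))%Z) o) (act (e (-1)%Z) o))
        as [H|H]; rewrite (gromov_sym o (act (e n) o) (act (e (-1)%Z) o)) in H; [lra|exfalso].
      rewrite gromov_sym, gromov_base_swap in H.
      pose proof (Hshift (-1)%Z 0%Z 1%Z (- Z.of_nat m)%Z) as Hs.
      replace (-1 + - Z.of_nat m)%Z with (- Z.of_nat (S m))%Z in Hs by lia.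
      change (-1 + 0)%Z with (-1)%Z in Hs; change (-1 + 1)%Z with 0%Z in Hs.
      rewrite He0, gromov_sym, (gromov_sym o) in Hs.
      rewrite (gromov_sym _ o), Hs in H.
      pose proof (IH 1%Z ltac:(lia)).
      assert (d o (act (e (-1)%Z) o) = L).
      { rewrite <- He0 at 1; rewrite dist_sym; unfold L.
        change 0%Z with (-1 + 1)%Z; now rewrite He, actM, dist_act. }
      lra. }
    intros m n Hm Hn; rewrite <- (Z2Nat.id m Hm); now apply Hback.
  - intros r; exists (Z.max 0 (up (lam * (Rabs r + c)))); split; [lia|].
    intros n Hn.
    pose proof (Hgrow (Z.of_nat p * n)%Z) as H.
    assert (IZR (Z.abs n) <= IZR (Z.abs (Z.of_nat p * n))).
    { apply IZR_le; rewrite Z.abs_mul; nia. }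
    assert (lam * (Rabs r + c) <= IZR (Z.abs n)).
    { destruct (archimed (lam * (Rabs r + c))) as [Hu _].
      eapply Rle_trans; [apply Rlt_le, Hu|apply IZR_le; lia]. }
    assert (Rabs r + c <= IZR (Z.abs (Z.of_nat p * n)) / lam).
    { apply (Rmult_le_reg_l lam); [lra|].
      replace (lam * (IZR (Z.abs (Z.of_nat p * n)) / lam)) with (IZR (Z.abs (Z.of_nat p * n))) by (field; lra).
      lra. }
    pose proof (Rle_abs r); lra.
Qed.

(** * Sequences converging to infinity *)

Lemma equiv_infinity_trans u v w :
  equiv_infinity d o u v -> equiv_infinity d o v w -> equiv_infinity d o u w.
Proof.
  intros Huv Hvw M.
  destruct (Huv (M + delta)) as [N1 H1], (Hvw (M + delta)) as [N2 H2].
  exists (max N1 N2); intros i j Hi Hj.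
  specialize (H1 i (max N1 N2) ltac:(lia) ltac:(lia)).
  specialize (H2 (max N1 N2) j ltac:(lia) ltac:(lia)).
  destruct (gromov_ultra o (u i) (v (max N1 N2)) (w j)); lra.
Qed.

Lemma equiv_infinity_sym u v : equiv_infinity d o u v -> equiv_infinity d o v u.
Proof.
  intros H M; destruct (H M) as [N HN]; exists N; intros i j Hi Hj.
  rewrite gromov_sym; now apply HN.
Qed.

(** Inequivalence gives one far pair with product below [M]. Each tail has large products with
    itself, so the bound spreads to all far pairs at the cost of [2 * delta]. *)
Lemma non_equiv_bounded u v :
  cv_infinity d o u -> cv_infinity d o v -> ~ equiv_infinity d o u v ->
  exists M N, forall i j, (N <= i)%nat -> (N <= j)%nat -> gromov d o (u i) (v j) <= M.
Proof.
  intros Hu Hv Hne.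
  apply not_all_ex_not in Hne as [M HM].
  destruct (Hu (M + 2 * delta)) as [N1 H1], (Hv (M + 2 * delta)) as [N2 H2].
  assert (Hex : exists i0 j0, (max N1 N2 <= i0)%nat /\ (max N1 N2 <= j0)%nat /\
    gromov d o (u i0) (v j0) < M).
  { apply NNPP; intros Hno; apply HM; exists (max N1 N2); intros i j Hi Hj.
    apply Rnot_lt_ge; intros Hlt; apply Hno; now exists i, j. }
  destruct Hex as (i0 & j0 & Hi0 & Hj0 & Hlt).
  exists (M + 2 * delta), (max N1 N2); intros i j Hi Hj.
  apply Rnot_lt_le; intros Hgt.
  specialize (H1 i0 i ltac:(lia) ltac:(lia)); specialize (H2 j j0 ltac:(lia) ltac:(lia)).
  destruct (gromov_ultra o (u i0) (v j) (v j0)) as [H|H]; [|lra].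
  destruct (gromov_ultra o (u i0) (u i) (v j)) as [H'|H']; lra.
Qed.

Lemma cv_infinity_escapes u : cv_infinity d o u ->
  forall r, exists N, forall n, (N <= n)%nat -> r <= d o (u n).
Proof.
  intros Hu r; destruct (Hu r) as [N HN]; exists N; intros n Hn.
  pose proof (HN n n Hn Hn); pose proof (gromov_le_left o (u n) (u n)); lra.
Qed.

(** * Metric geometry of a straight axis *)

Section Axis.
Variables (e : Z -> G) (s : R).
Hypothesis axis : straight_axis e s.

Let y n := act (e n) o.
Let L := d o (y 1).

Lemma axis_add m n : e (m + n)%Z = mul (e m) (e n).
Proof. apply axis. Qed.

Lemma axis_0 : e 0%Z = one.
Proof.
  apply (mul_inj (e 0%Z)); rewrite <- axis_add; now rewrite mulr1.
Qed.

Lemma axis_opp n : e (- n)%Z = inv (e n).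
Proof.
  apply (mul_inj (e n)); rewrite <- axis_add, mulVr, Z.add_opp_diag_r; apply axis_0.
Qed.

Lemma y_0 : y 0 = o.
Proof. unfold y; rewrite axis_0; apply act1. Qed.

Lemma y_add m n : y (m + n) = act (e m) (y n).
Proof. unfold y; now rewrite axis_add, actM. Qed.

Lemma dist_y m n : d (y m) (y n) = d o (y (n - m)).
Proof.
  rewrite <- (dist_act (e m) o), <- y_add; f_equal; f_equal; lia.
Qed.

Lemma dist_o_y_opp n : d o (y (- n)) = d o (y n).
Proof. rewrite (dist_sym o (y n)), <- y_0 at 1; rewrite y_0, <- y_0, !dist_y; do 2 f_equal; lia. Qed.

Lemma dist_o_y_le n : d o (y n) <= IZR (Z.abs n) * L.
Proof.
  assert (H : forall m : nat, d o (y (Z.of_nat m)) <= INR m * L).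
  { induction m as [|m IH]; [simpl Z.of_nat; rewrite y_0, dist_self; simpl; lra|].
    rewrite S_INR, Nat2Z.inj_succ.
    pose proof (dist_tri o (y (Z.of_nat m)) (y (Z.succ (Z.of_nat m)))) as Ht.
    rewrite (dist_y (Z.of_nat m)) in Ht.
    replace (Z.succ (Z.of_nat m) - Z.of_nat m)%Z with 1%Z in Ht by lia.
    fold L in Ht; lra. }
  destruct (Z.le_gt_cases 0 n) as [Hn|Hn].
  - specialize (H (Z.to_nat n)); rewrite INR_IZR_INZ, Z2Nat.id in H by lia.
    now rewrite Z.abs_eq by lia.
  - specialize (H (Z.to_nat (- n))); rewrite INR_IZR_INZ, Z2Nat.id, dist_o_y_opp in H by lia.
    now rewrite Z.abs_neq by lia.
Qed.

Lemma y_escapes r : exists N, (0 <= N)%Z /\ forall n, (N <= Z.abs n)%Z -> r <= d o (y n).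
Proof. apply axis. Qed.

Lemma y_straight i m j :
  (i <= m <= j)%Z \/ (j <= m <= i)%Z -> gromov d (y m) (y i) (y j) <= s.
Proof.
  assert (H : forall i j, (i <= m <= j)%Z -> gromov d (y m) (y i) (y j) <= s).
  { intros i' j' Hm; rewrite <- (gromov_act (e (- m)%Z)), <- !y_add.
    rewrite Z.add_opp_diag_l, y_0.
    replace (- m + i')%Z with (- (m - i'))%Z by lia.
    apply axis; lia. }
  intros [Hm|Hm]; [|rewrite gromov_sym]; now apply H.
Qed.

Lemma straight_ge0 : 0 <= s.
Proof.
  eapply Rle_trans; [apply gromov_ge0|apply (y_straight 0 0 0); lia].
Qed.

(** Along one side, straightness makes distances from [o] additive up to [2 * s], so the distance
    from [o] determines the position. *)
Lemma dist_y_same_side a b :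
  (0 <= a)%Z /\ (0 <= b)%Z \/ (a <= 0)%Z /\ (b <= 0)%Z ->
  d (y a) (y b) <= Rabs (d o (y a) - d o (y b)) + 2 * s.
Proof.
  assert (H : forall a b, (0 <= a <= b)%Z \/ (b <= a <= 0)%Z ->
    d (y a) (y b) <= d o (y b) - d o (y a) + 2 * s).
  { intros a' b' Hab; pose proof (y_straight 0 a' b' ltac:(lia)) as Hs.
    rewrite y_0 in Hs; unfold gromov in Hs; rewrite (dist_sym (y a') o) in Hs; lra. }
  intros Hs.
  destruct (Z.le_gt_cases (Z.abs a) (Z.abs b)) as [Hab|Hab].
  - specialize (H a b ltac:(lia)); pose proof (Rle_abs (- (d o (y a) - d o (y b)))) as Ha.
    rewrite Rabs_Ropp in Ha; lra.
  - specialize (H b a ltac:(lia)); pose proof (Rle_abs (d o (y a) - d o (y b))).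
    rewrite dist_sym; lra.
Qed.

(** Discrete intermediate values: [p] is the last index before the orbit, moving by steps of length
    [L], first leaves the ball of radius [r] about [y i]. *)
Lemma y_intermediate i j r : (i <= j)%Z -> 0 <= r ->
  exists p, (i <= p <= j)%Z /\ d (y i) (y p) <= r /\ (p = j \/ r < d (y i) (y p) + L).
Proof.
  intros Hij Hr; replace j with (i + Z.of_nat (Z.to_nat (j - i)))%Z by lia.
  generalize (Z.to_nat (j - i)); clear j Hij; intros n.
  induction n as [|n (p & Hp & Hpr & Hor)].
  - exists i; rewrite dist_self; split; [lia|split; [exact Hr|left; lia]].
  - destruct Hor as [->|Hlt]; [|exists p; split; [lia|auto]].
    destruct (Rle_lt_dec (d (y i) (y (i + Z.of_nat (S n)))) r) as [H|H].
    + exists (i + Z.of_nat (S n))%Z; split; [lia|auto].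
    + exists (i + Z.of_nat n)%Z; split; [lia|split; [exact Hpr|right]].
      pose proof (dist_tri (y i) (y (i + Z.of_nat n)) (y (i + Z.of_nat (S n)))) as Ht.
      rewrite (dist_y (i + Z.of_nat n)) in Ht.
      replace (i + Z.of_nat (S n) - (i + Z.of_nat n))%Z with 1%Z in Ht by lia.
      fold L in Ht; lra.
Qed.

(** The point [y p] is chosen about as far from [y i] as [w] is. It falls short by at most [L], or
    by at most [2 * M] if the segment ends first, and hyperbolicity at [w] then brings it close to
    [w]. *)
Lemma near_axis w i j M :
  gromov d w (y i) (y j) <= M ->
  exists p, ((i <= p <= j)%Z \/ (j <= p <= i)%Z) /\
    d w (y p) <= 2 * (s + M) + L + 2 * delta.
Proof.
  assert (Hmain : forall i j, (i <= j)%Z -> gromov d w (y i) (y j) <= M ->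
    exists p, (i <= p <= j)%Z /\ d w (y p) <= 2 * (s + M) + L + 2 * delta).
  { clear i j; intros i j Hij Hw.
    destruct (y_intermediate i j (d (y i) w) Hij (dist_ge0 _ _)) as (p & Hp & Hle & Hor).
    exists p; split; [exact Hp|].
    pose proof (gromov_ge0 w (y i) (y j)) as HM.
    pose proof straight_ge0 as Hs0.
    pose proof (y_straight i p j (or_introl Hp)) as Hs.
    pose proof (dist_tri (y i) w (y j)) as Ht1.
    assert (HL : 0 <= L) by apply dist_ge0.
    assert (Hge : d (y i) w <= d (y i) (y p) + L + 2 * M).
    { destruct Hor as [->|H]; [|lra].
      unfold gromov in Hw; rewrite (dist_sym w (y i)) in Hw.
      pose proof (dist_ge0 w (y j)); lra. }
    destruct (gromov_ultra w (y i) (y p) (y j)) as [H|H];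
      unfold gromov in *;
      rewrite ?(dist_sym w (y i)), ?(dist_sym (y p) (y i)), ?(dist_sym (y j) (y p)) in *; lra. }
  intros Hw; destruct (Z.le_gt_cases i j) as [Hij|Hij].
  - destruct (Hmain i j Hij Hw) as (p & Hp & Hd); eauto.
  - rewrite gromov_sym in Hw; destruct (Hmain j i ltac:(lia) Hw) as (p & Hp & Hd); eauto.
Qed.

(** * Axes sharing an endpoint; a sign selects one end of an axis *)

Definition is_sign (z : Z) : Prop := z = 1%Z \/ z = (-1)%Z.

(* The assumption says that the axes of [e] and of its [g]-conjugate share an endpoint.  They then
   fellow travel, so that the elements [e (- tau n) g e (sigma n)] move [o] by a bounded amount and
   properness forces two of them to coincide. *)
Lemma asymptotic_axes_commensurable g :
  (forall r, exists i j, r < gromov d o (y i) (act g (y j))) ->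
  exists m sigma tau, (0 < m)%Z /\ is_sign sigma /\ is_sign tau /\
    mul g (e (sigma * m)%Z) = mul (e (tau * m)%Z) g.
Proof.
  intros Hbad.
  set (D := d o (act g o)).
  set (C1 := 2 * (s + (s + D + delta)) + L + 2 * delta).
  assert (Hnear : forall n : nat, exists sigma tau, is_sign sigma /\ is_sign tau /\
    d (act g (y (sigma * Z.of_nat n))) (y (tau * Z.of_nat n)) <= 2 * C1 + D + 2 * s).
  { intros n.
    (* The threshold forces [|j| > n], because the product is at most [d o (act g (y j))], hence at
       most [D + |j| * L]. *)
    destruct (Hbad (D + INR n * L)) as (i & j & Hij).
    assert (Hgy : forall q, d o (act g (y q)) <= D + d o (y q)).
    { intros q; pose proof (dist_tri o (act g o) (act g (y q))) as H.
      rewrite dist_act in H; exact H. }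
    assert (Hj : (Z.of_nat n < Z.abs j)%Z).
    { apply Z.nle_gt; intros Hle; apply IZR_le in Hle; rewrite <- INR_IZR_INZ in Hle.
      pose proof (gromov_le_right o (y i) (act g (y j))); pose proof (Hgy j).
      pose proof (dist_o_y_le j).
      assert (IZR (Z.abs j) * L <= INR n * L)
        by (apply Rmult_le_compat_r; [apply dist_ge0|exact Hle]).
      lra. }
    set (sigma := (if Z_le_dec 0 j then 1 else -1)%Z).
    set (q := (sigma * Z.of_nat n)%Z).
    assert (Hq : (0 <= q <= j)%Z \/ (j <= q <= 0)%Z).
    { unfold q, sigma; destruct (Z_le_dec 0 j); lia. }
    assert (Hqabs : Z.abs q = Z.of_nat n).
    { unfold q, sigma; destruct (Z_le_dec 0 j); lia. }
    pose proof (y_straight 0 q j Hq) as Hs; rewrite y_0 in Hs.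
    rewrite <- (gromov_act g) in Hs.
    pose proof (gromov_move_left (act g (y q)) o (act g o) (act g (y j))) as Hs'; fold D in Hs'.
    assert (Hbase : gromov d o (act g (y q)) (act g (y j)) >= d o (act g (y q)) - (s + D)).
    { rewrite gromov_base_swap; lra. }
    assert (Hyq : d o (y q) <= INR n * L).
    { rewrite INR_IZR_INZ, <- Hqabs; apply dist_o_y_le. }
    pose proof (Hgy q).
    (* Seen from [o], the products of [act g (y j)] with [act g (y q)] and with [y i] both nearly
       reach [d o (act g (y q))], so [act g (y q)] lies almost between [o] and [y i]. *)
    assert (Hi : gromov d (act g (y q)) (y 0) (y i) <= s + D + delta).
    { rewrite y_0.
      pose proof (gromov_base_swap o (act g (y q)) (y i)).
      pose proof (gromov_ge0 (act g (y q)) o (act g (y j))).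
      pose proof straight_ge0; assert (0 <= D) by apply dist_ge0.
      destruct (gromov_ultra o (act g (y q)) (act g (y j)) (y i)) as [Hu|Hu]; [lra|].
      rewrite (gromov_sym o (act g (y j))) in Hu; lra. }
    destruct (near_axis _ _ _ _ Hi) as (p & Hp & Hdp); fold C1 in Hdp.
    (* The index [p] is uncontrolled, but [y p] lies on the side [tau] at nearly the distance from
       [o] of [y (tau * n)]; it can thus be replaced by that point. *)
    set (tau := (if Z_le_dec 0 i then 1 else -1)%Z).
    exists sigma, tau; split; [|split].
    - unfold is_sign, sigma; destruct (Z_le_dec 0 j); auto.
    - unfold is_sign, tau; destruct (Z_le_dec 0 i); auto.
    - fold q.
      assert (Htau : d o (y (tau * Z.of_nat n)) = d o (y q)).
      { unfold tau, q, sigma; destruct (Z_le_dec 0 i), (Z_le_dec 0 j);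
          rewrite ?Z.mul_1_l, ?Z.mul_opp_l, ?dist_o_y_opp; try reflexivity;
          change (-1 * Z.of_nat n)%Z with (- (1 * Z.of_nat n))%Z;
          now rewrite dist_o_y_opp, Z.mul_1_l. }
      pose proof (dist_y_same_side p (tau * Z.of_nat n)) as Hside.
      rewrite Htau in Hside.
      pose proof (dist_tri (act g (y q)) (y p) (y (tau * Z.of_nat n))).
      assert (Rabs (d o (y p) - d o (y q)) <= C1 + D).
      { pose proof (dist_tri o (act g (y q)) (y p)).
        pose proof (dist_tri o (y p) (act g (y q))) as H2.
        rewrite (dist_sym (y p)) in H2.
        pose proof (dist_tri (act g o) o (act g (y q))) as H3.
        rewrite dist_act, (dist_sym (act g o)) in H3; fold D in H3.
        apply Rabs_le; lra. }
      assert (d (y p) (y (tau * Z.of_nat n)) <= C1 + D + 2 * s).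
      { eapply Rle_trans; [apply Hside; unfold tau; destruct (Z_le_dec 0 i); lia|lra]. }
      lra. }
  destruct (proper o (2 * C1 + D + 2 * s)) as [l Hl].
  destruct (infinite_pigeonhole _
    (fun n t => is_sign (fst (fst t)) /\ is_sign (snd (fst t)) /\
       snd t = mul (e (- (snd (fst t) * Z.of_nat n))%Z) (mul g (e (fst (fst t) * Z.of_nat n)%Z)))
    (list_prod (list_prod (1%Z :: (-1)%Z :: nil) (1%Z :: (-1)%Z :: nil)) l) 0)
    as (n & n' & [[sigma tau] c] & Hlt & (Hsig & Htau & Hn) & (_ & _ & Hn')).
  { intros n _; destruct (Hnear n) as (sigma & tau & Hsig & Htau & Hd).
    exists (sigma, tau, mul (e (- (tau * Z.of_nat n))%Z) (mul g (e (sigma * Z.of_nat n)%Z))).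
    split; [|now cbn].
    apply in_prod; [apply in_prod; [destruct Hsig as [->| ->]|destruct Htau as [->| ->]]; simpl; auto|].
    apply Hl; rewrite axis_opp, !actM, dist_sym, dist_act_inv; exact Hd. }
  simpl in *; exists (Z.of_nat n' - Z.of_nat n)%Z, sigma, tau.
  split; [lia|split; [exact Hsig|split; [exact Htau|]]].
  rewrite Hn in Hn'.
  apply (f_equal (fun x => mul (e (tau * Z.of_nat n')%Z) (mul x (e (- (sigma * Z.of_nat n))%Z)))) in Hn'.
  rewrite !mulA, <- !axis_add, <- !mulA, <- !axis_add in Hn'.
  rewrite !Z.add_opp_diag_r, axis_0, mulr1, mul1 in Hn'.
  rewrite !Z.mul_sub_distr_l; symmetry; exact Hn'.
Qed.

Lemma intertwine_powers g a b :
  mul g (e a) = mul (e b) g -> forall i, mul g (e (a * i)%Z) = mul (e (b * i)%Z) g.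
Proof.
  intros Hg.
  assert (Hnat : forall n : nat, mul g (e (a * Z.of_nat n)%Z) = mul (e (b * Z.of_nat n)%Z) g).
  { induction n as [|n IH]; [now rewrite !Z.mul_0_r, axis_0, mulr1, mul1|].
    rewrite Nat2Z.inj_succ, !Z.mul_succ_r, !axis_add, mulA, IH, <- !mulA; now rewrite Hg. }
  intros i; destruct (Z.le_gt_cases 0 i) as [Hi|Hi].
  - rewrite <- (Z2Nat.id i Hi); apply Hnat.
  - replace i with (- Z.of_nat (Z.to_nat (- i)))%Z by lia.
    rewrite !Z.mul_opp_r, !axis_opp.
    apply (mul_inj (e (b * Z.of_nat (Z.to_nat (- i)))%Z)).
    now rewrite mulVK, mulA, <- Hnat, <- mulA, mulVr, mulr1.
Qed.

(** Far out in both directions the translated axis stays at distance [D] from the axis. Since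
    [act g o] lies between far points of the former, it lies almost between the matching points of
    the latter. The final bound does not depend on [g]. *)
Lemma commensurable_near_axis g m sigma tau :
  (0 < m)%Z -> is_sign sigma -> is_sign tau ->
  mul g (e (sigma * m)%Z) = mul (e (tau * m)%Z) g ->
  exists p, d (act g o) (y p) <= 2 * (s + (s + 2 * delta)) + L + 2 * delta.
Proof.
  intros Hm Hsig Htau Hg.
  set (D := d o (act g o)).
  assert (Hclose : forall i, d (act g (y (sigma * m * i))) (y (tau * m * i)) = D).
  { intros i; unfold y; rewrite <- actM, (intertwine_powers g _ _ Hg), actM, dist_act.
    apply dist_sym. }
  (* Far enough that matching points have product above [s + 2 * delta] at [act g o], which rules
     out the unwanted alternatives below. *)
  destruct (y_escapes (s + 2 * delta + D + 1)) as (N & HN0 & HN).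
  assert (Hfar : forall i, i = N \/ i = (- N)%Z ->
    gromov d (act g o) (act g (y (sigma * m * i))) (y (tau * m * i)) > s + 2 * delta).
  { intros i Hi.
    pose proof (gromov_base_swap (act g o) (act g (y (sigma * m * i))) (y (tau * m * i))).
    pose proof (gromov_le_right (act g (y (sigma * m * i))) (act g o) (y (tau * m * i))).
    rewrite Hclose in *; rewrite dist_act in *.
    specialize (HN (sigma * m * i)%Z).
    assert (N <= Z.abs (sigma * m * i))%Z by (destruct Hsig as [->| ->], Hi as [->| ->]; nia).
    specialize (HN ltac:(assumption)); lra. }
  assert (Hs : gromov d (act g o) (act g (y (sigma * m * N))) (act g (y (sigma * m * - N))) <= s).
  { rewrite gromov_act, <- y_0; apply y_straight; destruct Hsig as [->| ->]; nia. }
  pose proof (Hfar N (or_introl eq_refl)) as H1.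
  pose proof (Hfar (- N)%Z (or_intror eq_refl)) as H2.
  assert (Hy : gromov d (act g o) (y (tau * m * N)) (y (tau * m * - N)) <= s + 2 * delta).
  { destruct (gromov_ultra (act g o) (act g (y (sigma * m * N))) (y (tau * m * N))
      (act g (y (sigma * m * - N)))) as [H|H]; [lra|].
    destruct (gromov_ultra (act g o) (y (tau * m * N)) (y (tau * m * - N))
      (act g (y (sigma * m * - N)))) as [H'|H']; [lra|].
    rewrite (gromov_sym _ (y (tau * m * - N))) in H'; lra. }
  destruct (near_axis _ _ _ _ Hy) as (p & _ & Hp); now exists p.
Qed.

(** * Orbit points and translates transverse to the axis *)

Lemma y_cv_infinity sigma : is_sign sigma ->
  cv_infinity d o (fun n => y (sigma * Z.of_nat n)).
Proof.
  intros Hsig r; destruct (y_escapes (r + s)) as (N & HN0 & HN).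
  assert (Hle : forall i j, (Z.to_nat N <= i <= j)%nat ->
    gromov d o (y (sigma * Z.of_nat i)) (y (sigma * Z.of_nat j)) >= r).
  { intros i j Hij; rewrite gromov_base_swap.
    pose proof (y_straight 0 (sigma * Z.of_nat i) (sigma * Z.of_nat j)) as Hs.
    rewrite y_0 in Hs.
    specialize (Hs ltac:(destruct Hsig as [->| ->]; lia)).
    specialize (HN (sigma * Z.of_nat i)%Z ltac:(destruct Hsig as [->| ->]; lia)); lra. }
  exists (Z.to_nat N); intros i j Hi Hj.
  destruct (Nat.le_gt_cases i j); [apply Hle; lia|rewrite gromov_sym; apply Hle; lia].
Qed.

(** The axis has two ends, so of three pairwise inequivalent limit points one differs from both. *)
Lemma exists_limit_off_axis :
  non_elementary d act o ->
  exists u, in_orbit_seq act o u /\ cv_infinity d o u /\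
    forall sigma, is_sign sigma -> ~ equiv_infinity d o u (fun n => y (sigma * Z.of_nat n)).
Proof.
  intros (u1 & u2 & u3 & O1 & O2 & O3 & C1 & C2 & C3 & N12 & N13 & N23).
  apply NNPP; intros Hno.
  assert (H : forall u, in_orbit_seq act o u -> cv_infinity d o u ->
    exists sigma, is_sign sigma /\ equiv_infinity d o u (fun n => y (sigma * Z.of_nat n))).
  { intros u Ou Cu; apply NNPP; intros Hu; apply Hno; exists u; split; [|split]; auto.
    intros sigma Hsig He; apply Hu; now exists sigma. }
  assert (Htr : forall u v w, equiv_infinity d o u w -> equiv_infinity d o v w ->
    equiv_infinity d o u v).
  { intros u v w Hu Hv; eapply equiv_infinity_trans; [exact Hu|now apply equiv_infinity_sym]. }
  destruct (H u1 O1 C1) as (s1 & S1 & E1), (H u2 O2 C2) as (s2 & S2 & E2),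
    (H u3 O3 C3) as (s3 & S3 & E3).
  destruct S1 as [->| ->], S2 as [->| ->], S3 as [->| ->]; eauto.
Qed.

(** The points are taken far along a sequence converging off the axis. Inequivalence with each ray
    bounds the products for large [|j|]; for [|j| <= N] they are at most [d o (y j) <= N * L]. *)
Lemma exists_orbit_points_off_axis :
  non_elementary d act o ->
  exists M, forall r, exists g, r <= d o (act g o) /\ forall j, gromov d o (act g o) (y j) <= M.
Proof.
  intros Hne; destruct (exists_limit_off_axis Hne) as (u & Ou & Cu & Hu).
  destruct (non_equiv_bounded u _ Cu (y_cv_infinity 1 (or_introl eq_refl)) (Hu _ (or_introl eq_refl)))
    as (M1 & N1 & H1).
  destruct (non_equiv_bounded u _ Cu (y_cv_infinity (-1) (or_intror eq_refl)) (Hu _ (or_intror eq_refl)))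
    as (M2 & N2 & H2).
  set (N := max N1 N2).
  exists (Rabs M1 + Rabs M2 + INR N * L); intros r.
  destruct (cv_infinity_escapes u Cu r) as [N3 H3].
  destruct (Ou (max N N3)) as [g Hg].
  exists g; rewrite <- Hg; split; [apply H3; lia|intros j].
  assert (HL : 0 <= L) by apply dist_ge0.
  pose proof (Rabs_pos M1); pose proof (Rabs_pos M2).
  pose proof (Rle_abs M1); pose proof (Rle_abs M2).
  assert (0 <= INR N * L) by (apply Rmult_le_pos; [apply pos_INR|exact HL]).
  destruct (Z.le_gt_cases (Z.abs j) (Z.of_nat N)) as [Hj|Hj].
  - pose proof (gromov_le_right o (u (max N N3)) (y j)); pose proof (dist_o_y_le j).
    assert (IZR (Z.abs j) * L <= INR N * L)
      by (apply Rmult_le_compat_r; [exact HL|rewrite INR_IZR_INZ; now apply IZR_le]).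
    lra.
  - destruct (Z.le_gt_cases 0 j) as [Hs|Hs].
    + specialize (H1 (max N N3) (Z.to_nat j) ltac:(lia) ltac:(lia)).
      replace (1 * Z.of_nat (Z.to_nat j))%Z with j in H1 by lia; lra.
    + specialize (H2 (max N N3) (Z.to_nat (- j)) ltac:(lia) ltac:(lia)).
      replace (-1 * Z.of_nat (Z.to_nat (- j)))%Z with j in H2 by lia; lra.
Qed.

Lemma exists_transverse :
  non_elementary d act o ->
  exists f C, forall i j, gromov d o (y i) (act f (y j)) <= C.
Proof.
  intros Hne; destruct (exists_orbit_points_off_axis Hne) as [M HM].
  (* If the axes shared an endpoint, [act g o] would be within the bracketed bound of some [y p];
     with product at most [M] at [o], this would give [d o (act g o)] at most [M] plus that
     bound. *)
  destruct (HM (M + (2 * (s + (s + 2 * delta)) + L + 2 * delta) + 1)) as (g & Hg & HgM).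
  exists g; apply NNPP; intros Hno.
  destruct (asymptotic_axes_commensurable g) as (m & sigma & tau & Hm & Hsig & Htau & Hcomm).
  { intros r; apply NNPP; intros Hr; apply Hno; exists r; intros i j.
    apply Rnot_lt_le; intros Hlt; apply Hr; now exists i, j. }
  destruct (commensurable_near_axis g m sigma tau Hm Hsig Htau Hcomm) as [p Hp].
  specialize (HgM p).
  pose proof (gromov_base_swap o (act g o) (y p)).
  pose proof (gromov_le_right (act g o) o (y p)); lra.
Qed.

(** The axis and its [f0]-translate have mutual products at most [C0], so [act g o] cannot have
    product above [C0 + delta] with points of both. Thus [f] is [one] or [f0], which keeps [C]
    uniform in [g]. *)
Lemma transverse_translate (A : X -> Prop) r a :
  non_elementary d act o ->
  A a -> (forall x, A x -> exists i, d x (y i) <= r) ->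
  exists C, forall g, exists f,
    (forall x, translate act f A x -> gromov d o x (act g o) <= C) /\
    exists x, translate act f A x /\ d o x <= C.
Proof.
  intros Hne Ha HA; destruct (exists_transverse Hne) as (f0 & C0 & HC0).
  assert (Hr : 0 <= r) by (destruct (HA a Ha) as [i Hi]; pose proof (dist_ge0 a (y i)); lra).
  assert (H0 : 0 <= C0) by (eapply Rle_trans; [apply gromov_ge0|apply (HC0 0%Z 0%Z)]).
  assert (Hfo : 0 <= d o (act f0 o)) by apply dist_ge0.
  assert (Hoa : 0 <= d o a) by apply dist_ge0.
  exists (C0 + delta + r + d o a + d o (act f0 o)); intros g.
  assert (Hor : exists f, (f = one \/ f = f0) /\
    forall j, gromov d o (act f (y j)) (act g o) <= C0 + delta).
  { destruct (classic (forall i, gromov d o (y i) (act g o) <= C0 + delta)) as [Hall|Hex].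
    - exists one; split; [now left|intros j; rewrite act1; apply Hall].
    - exists f0; split; [now right|intros j].
      apply not_all_ex_not in Hex as [i Hi].
      specialize (HC0 i j).
      destruct (gromov_ultra o (y i) (act g o) (act f0 (y j))) as [H|H];
        [|rewrite gromov_sym]; lra. }
  destruct Hor as (f & Hf & Hprod); exists f; split.
  - intros x (x' & Hx' & ->); destruct (HA x' Hx') as [i Hi]; specialize (Hprod i).
    pose proof (gromov_move_left o (act f x') (act f (y i)) (act g o)) as H.
    rewrite dist_act in H; lra.
  - exists (act f a); split; [now exists a|].
    pose proof (dist_tri o (act f o) (act f a)) as H; rewrite dist_act in H.
    destruct Hf as [->| ->]; [rewrite (act1 o), dist_self in H|]; lra.
Qed.
End Axis.

(** * Cocompact virtually cyclic groups *)

Lemma seq_compact_bounded (C : X -> Prop) :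
  seq_compact d C -> exists B, forall x, C x -> d o x <= B.
Proof.
  intros HC; apply NNPP; intros Hno.
  assert (Hfar : forall n : nat, exists x, C x /\ INR n < d o x).
  { intros n; apply NNPP; intros Hn; apply Hno; exists (INR n); intros x Hx.
    apply Rnot_lt_le; intros Hlt; apply Hn; now exists x. }
  destruct (functional_choice _ Hfar) as [u Hu].
  destruct (HC u (fun n => proj1 (Hu n))) as (phi & x & Hphi & _ & Hcv).
  destruct (Hcv 1 Rlt_0_1) as [N HN].
  destruct (INR_unbounded (d o x + 1)) as [m Hm].
  assert (Hge : forall n, (n <= phi n)%nat).
  { induction n as [|n IH]; [lia|specialize (Hphi n); lia]. }
  specialize (HN (max N m) ltac:(lia)); destruct (Hu (phi (max N m))) as [_ Hlt].
  pose proof (dist_tri o x (u (phi (max N m)))) as Ht; rewrite (dist_sym x) in Ht.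
  assert (INR m <= INR (phi (max N m))) by (apply le_INR; specialize (Hge (max N m)); lia).
  lra.
Qed.

Lemma powZ_subgroup (H : G -> Prop) h n :
  subgroup mul one inv H -> H h -> H (powZ mul one inv h n).
Proof.
  intros (H1 & Hm & Hi) Hh.
  assert (HN : forall m, H (powN mul one h m)) by (induction m; simpl; auto).
  destruct n; simpl; auto.
Qed.

(* A common power of [z] and [e 1] lets [e] absorb all but boundedly much of each element. *)
Lemma virtually_cyclic_near_axis (H : G -> Prop) e s :
  straight_axis e s -> (forall n, H (e n)) -> virtually_cyclic mul one inv H ->
  exists r, forall g, H g -> exists n, d (act g o) (act (e n) o) <= r.
Proof.
  intros Hax HeH [Hsub (z & Hz & l & Hl & Hdec)].
  (* Two elements [e n], [e n'] share a left coset of the powers of [z]; their quotient is a power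
     of both [e 1] and [z]. *)
  destruct (infinite_pigeonhole _ (fun n y => exists k, e (Z.of_nat n) = mul y (powZ mul one inv z k)) l 0)
    as (n & n' & y & Hlt & [k Hk] & [k' Hk']).
  { intros n _; destruct (Hdec _ (HeH (Z.of_nat n))) as (y & k & Hy & Hyk); now exists y; split; [|exists k]. }
  set (m := (Z.of_nat n' - Z.of_nat n)%Z); set (q := (k' - k)%Z).
  assert (Hm : (0 < m)%Z) by (unfold m; lia).
  assert (Hem : e m = powZ mul one inv z q).
  { apply (mul_inj (e (Z.of_nat n))); rewrite <- (axis_add e s Hax).
    unfold m; rewrite Zplus_minus, Hk, Hk', <- mulA, <- powZ_add.
    unfold q; now rewrite Zplus_minus. }
  assert (Hpow : forall t, e (m * t)%Z = powZ mul one inv z (q * t)).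
  { assert (Hstep : forall t, e (m * Z.succ t)%Z = mul (e (m * t)%Z) (e m)).
    { intros t; now rewrite Z.mul_succ_r, (axis_add e s Hax). }
    apply Z.peano_ind.
    - rewrite !Z.mul_0_r; apply (axis_0 e s Hax).
    - intros t IH; now rewrite Hstep, IH, Hem, Z.mul_succ_r, powZ_add.
    - intros t IH; rewrite <- (Z.succ_pred t), Hstep, Z.mul_succ_r, powZ_add, Hem in IH.
      apply (f_equal (fun x => mul x (inv (powZ mul one inv z q)))) in IH.
      now rewrite <- !mulA, mulVr, !mulr1 in IH. }
  assert (Hq : q <> 0%Z).
  { intros Hq0; destruct (proj2 (proj2 Hax) 1) as (N & HN0 & HN).
    specialize (HN (m * N)%Z); rewrite Hpow, Hq0, act1, dist_self in HN.
    specialize (HN ltac:(nia)); lra. }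
  destruct (list_upper_bound _ (fun y => d o (act y o)) l) as (B & HB0 & HB).
  destruct (list_upper_bound _ (fun i => d o (act (powZ mul one inv z (Z.of_nat i)) o))
    (seq 0 (Z.to_nat (Z.abs q)))) as (B' & HB0' & HB').
  exists (B + B'); intros g Hg.
  (* Decomposing [inv g] writes [g] as a power of [z] times [inv w]; the bounded factor then acts
     first and moves [o] boundedly. *)
  destruct (Hdec (inv g) (proj2 (proj2 Hsub) _ Hg)) as (w & j & Hw & Hwj).
  (* Division with remainder by [|q|]; the sign of [q] goes into [t], so that [i] is a nonnegative
     remainder. *)
  set (t := (Z.sgn q * (j / Z.abs q))%Z); set (i := (j mod Z.abs q)%Z).
  assert (Hi : (0 <= i < Z.abs q)%Z) by (apply Z.mod_pos_bound; lia).
  assert (Hj : j = (i + q * t)%Z).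
  { unfold i, t; rewrite Z.mul_assoc, Z.sgn_abs.
    pose proof (Z.div_mod j (Z.abs q) ltac:(lia)); nia. }
  exists (- (m * t))%Z.
  assert (He : mul (e (m * t)%Z) g = inv (mul w (powZ mul one inv z i))).
  { apply (mul_inj (mul w (powZ mul one inv z i))).
    rewrite mulVr, mulA, Hpow, <- (mulA w), <- powZ_add, <- Hj, <- Hwj; apply mulV. }
  rewrite (axis_opp e s Hax), dist_sym, dist_act_inv, <- actM, He, dist_sym, dist_act_inv, actM.
  eapply Rle_trans; [apply (dist_tri _ (act w o))|].
  rewrite dist_act.
  specialize (HB w Hw); specialize (HB' (Z.to_nat i)); rewrite Z2Nat.id in HB' by lia.
  specialize (HB' ltac:(apply in_seq; lia)); simpl in HB; lra.
Qed.

Lemma cocompact_near_axis (H : G -> Prop) h (A : X -> Prop) :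
  loxodromic d mul one inv act o h -> H h -> virtually_cyclic mul one inv H ->
  cocompact d act H A ->
  exists e s r, straight_axis e s /\ forall x, A x -> exists i, d x (act (e i) o) <= r.
Proof.
  intros Hlox Hh Hvc (C & HC & Hcov).
  destruct (loxodromic_straight_axis h Hlox) as (p & s & Hp & Hax).
  destruct (seq_compact_bounded C HC) as [B HB].
  destruct (virtually_cyclic_near_axis H _ s Hax) as [r Hr]; [|exact Hvc|].
  { intros n; apply powZ_subgroup; [apply Hvc|exact Hh]. }
  exists (fun n => powZ mul one inv h (p * n)), s, (B + r); split; [exact Hax|].
  intros x Hx; destruct (Hcov x Hx) as (g & x' & Hg & Hx' & ->).
  destruct (Hr g Hg) as [n Hn]; exists n.
  pose proof (dist_tri (act g x') (act g o) (act (powZ mul one inv h (p * n)) o)) as Ht.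
  rewrite dist_act, (dist_sym x') in Ht; specialize (HB x' Hx'); lra.
Qed.

Lemma cocompact_transverse_translate (H : G -> Prop) h (A : X -> Prop) a :
  non_elementary d act o ->
  loxodromic d mul one inv act o h -> H h -> virtually_cyclic mul one inv H ->
  cocompact d act H A -> A a ->
  exists C, forall g, exists f,
    (forall x, translate act f A x -> gromov d o x (act g o) <= C) /\
    exists x, translate act f A x /\ d o x <= C.
Proof.
  intros Hne Hlox Hh Hvc Hco Ha.
  destruct (cocompact_near_axis H h A Hlox Hh Hvc Hco) as (e & s & r & Hax & Hr).
  now apply (transverse_translate e s Hax A r a).
Qed.

(** * Bridges between translates *)

(** [A] passes near [o] and [B] near [p], and both leave transversally to the way from [o] to [p],
    which is therefore nearly a shortest connection. *)
Definition bridged (C : R) (A B : X -> Prop) (p : X) : Prop :=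
  (forall a, A a -> gromov d o a p <= C) /\ (forall b, B b -> gromov d p o b <= C) /\
  (exists a, A a /\ d o a <= C) /\ (exists b, B b /\ d p b <= C).

(** The broken path [a], [o], [p], [b] is straight at both corners. As [[o, p]] is long, the product
    of [o] and [a] at [p] is large, so hyperbolicity bounds that of [a] and [b]. *)
Lemma bridge_length C A B p a b :
  bridged C A B p -> 2 * C + delta < d o p -> A a -> B b ->
  d o a + d o p + d p b <= d a b + 4 * C + 2 * delta.
Proof.
  intros (HA & HB & _) Hp Ha Hb; specialize (HA a Ha); specialize (HB b Hb).
  destruct (gromov_ultra p o a b) as [H|H].
  - rewrite gromov_base_swap, (dist_sym p o), (gromov_sym o p) in H; lra.
  - unfold gromov in *; rewrite ?(dist_sym p o), ?(dist_sym p a), ?(dist_sym a o) in *; lra.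
Qed.

Lemma bridged_setdist C A B p :
  bridged C A B p -> 2 * C + delta < d o p ->
  Rbar_le (Finite (d o p - 4 * C - 2 * delta)) (setdist d A B) /\
  Rbar_le (setdist d A B) (Finite (d o p + 2 * C)).
Proof.
  intros Hbr Hp.
  destruct (Glb_Rbar_correct (fun r => exists a b, A a /\ B b /\ r = d a b)) as [Hlb Hglb].
  split.
  - apply Hglb; intros r (a & b & Ha & Hb & ->); simpl.
    pose proof (bridge_length C A B p a b Hbr Hp Ha Hb).
    pose proof (dist_ge0 o a); pose proof (dist_ge0 p b); lra.
  - destruct Hbr as (_ & _ & (a & Ha & Hoa) & (b & Hb & Hpb)).
    eapply Rbar_le_trans; [apply (Hlb (d a b)); now exists a, b|simpl].
    pose proof (dist_tri a o b); pose proof (dist_tri o p b).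
    rewrite (dist_sym a o) in *; lra.
Qed.

(* Nearly shortest segments between bridged sets start near [o] and end near [p], so an isometry
   between two bridged pairs of comparable length moves the endpoints boundedly. *)
Lemma bridged_isometry C A B p A' B' p' g r :
  bridged C A B p -> bridged C A' B' p' -> 2 * C + delta < d o p' -> d o p <= d o p' + r ->
  (forall a, A a -> A' (act g a)) -> (forall b, B b -> B' (act g b)) ->
  d o (act g o) <= 7 * C + 2 * delta + r /\ d (act g p) p' <= 7 * C + 2 * delta + r.
Proof.
  intros (_ & _ & (a & Ha & Hoa) & (b & Hb & Hpb)) Hbr' Hp' Hpp' HA HB.
  (* Since [d a b <= d o p + 2 * C], the ends [act g a] and [act g b] are within
     [6 * C + 2 * delta + r] of [o] and [p']; the seventh [C] passes from [a] to [o] and from [b] to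
     [p]. *)
  pose proof (bridge_length C A' B' p' _ _ Hbr' Hp' (HA a Ha) (HB b Hb)) as H.
  rewrite dist_act in H.
  pose proof (dist_tri a o b); pose proof (dist_tri o p b).
  pose proof (dist_tri o (act g a) (act g o)); pose proof (dist_tri p' (act g b) (act g p)).
  pose proof (dist_ge0 o (act g a)); pose proof (dist_ge0 p' (act g b)).
  rewrite !dist_act, (dist_sym a o), (dist_sym b p), (dist_sym p' (act g p)) in *; lra.
Qed.

(** The end at [act g o] is the situation at [o] for [inv g], moved by [g]. *)
Lemma exists_bridged (alpha beta : X -> Prop) C1 C2 :
  (forall g, exists f, (forall x, translate act f alpha x -> gromov d o x (act g o) <= C1) /\
    exists x, translate act f alpha x /\ d o x <= C1) ->
  (forall g, exists f, (forall x, translate act f beta x -> gromov d o x (act g o) <= C2) /\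
    exists x, translate act f beta x /\ d o x <= C2) ->
  forall g, exists q : G * G, bridged (Rmax C1 C2)
    (translate act (fst q) alpha) (translate act (snd q) beta) (act g o).
Proof.
  intros H1 H2 g.
  destruct (H1 g) as (f1 & Hf1 & x1 & Hx1 & Hd1).
  destruct (H2 (inv g)) as (f2 & Hf2 & x2 & Hx2 & Hd2).
  assert (Htr : forall b, translate act (mul g f2) beta b <-> translate act f2 beta (act (inv g) b)).
  { intros b; split; intros (b' & Hb' & Heq); exists b'; split; auto.
    - now rewrite Heq, actM, actK.
    - now rewrite actM, <- Heq, actVK. }
  pose proof (Rmax_l C1 C2); pose proof (Rmax_r C1 C2).
  exists (f1, mul g f2); repeat split; simpl.
  - intros a Ha; specialize (Hf1 a Ha); lra.
  - intros b Hb; specialize (Hf2 _ (proj1 (Htr b) Hb)).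
    rewrite <- (gromov_act g), !actVK, gromov_sym in Hf2; lra.
  - exists x1; split; [exact Hx1|lra].
  - exists (act g x2); split; [apply Htr; now rewrite actK|rewrite dist_act; lra].
Qed.

Lemma arcs_ge_annulus (alpha beta : X -> Prop) C Delta :
  (forall g, exists q : G * G, bridged C
    (translate act (fst q) alpha) (translate act (snd q) beta) (act g o)) ->
  0 < Delta ->
  exists Delta' c, 0 < Delta' /\ 0 < c /\
    exists N, forall n, N <= n ->
      card_ge_scaled (arc_rep d act alpha beta n Delta') (same_orbit act alpha beta)
                     c (annulus d act o n Delta) eq.
Proof.
  intros Hbr HDelta.
  assert (HC : 0 <= C).
  { destruct (Hbr one) as (q & _ & _ & (a & _ & Ha) & _).
    eapply Rle_trans; [apply dist_ge0|exact Ha]. }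
  (* The bound of [bridged_isometry] with [r = 2 * Delta], the width of the annulus. *)
  destruct (proper o (7 * C + 2 * delta + 2 * Delta)) as [S HS].
  set (M := (length S * length S)%nat).
  assert (HM : 0 < INR (M + 1)) by (apply lt_0_INR; lia).
  exists (Delta + 4 * C + 2 * delta), (/ INR (M + 1)).
  split; [lra|split; [now apply Rinv_0_lt_compat|]].
  (* This threshold puts every annulus point beyond the length [2 * C + delta] required of a
     bridge. *)
  exists (Delta + 2 * C + delta + 1); intros n Hn m (l & <- & Hl & Hpairs).
  destruct (functional_choice (fun p (q : G * G) => annulus d act o n Delta p -> bridged C
    (translate act (fst q) alpha) (translate act (snd q) beta) p)) as [F HF].
  { intros p; destruct (classic (annulus d act o n Delta p)) as [Hp|Hp].
    - pose proof Hp as [[g ->] _]; destruct (Hbr g) as [q Hq]; now exists q.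
    - now exists (one, one). }
  assert (Hdist : forall p, annulus d act o n Delta p -> n - Delta <= d o p <= n + Delta).
  { intros p [_ Hp]; apply Rabs_le_between in Hp; lra. }
  assert (Hnd : NoDup l).
  { clear - Hpairs; induction Hpairs as [|p l Hp _ IH]; constructor; [|exact IH].
    intros Hin; rewrite Forall_forall in Hp; now apply (Hp p). }
  destruct (sparse_sublist X (annulus d act o n Delta)
    (fun p p' => same_orbit act alpha beta (F p) (F p')) M) with (l := l)
    as (l' & Hincl & Hsparse & Hlen); auto.
  { intros p Hp; pose proof Hp as [[g1 Hg1] _].
    (* If [g] identifies the two pairs, then [p' = g g1 t o] with [t = inv (g g1) g2], and both [g]
       and [t] lie in the finite list [S]; this leaves at most [M] candidates. *)
    exists (map (fun t => act (mul (mul (fst t) g1) (snd t)) o) (list_prod S S)).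
    split; [rewrite length_map, length_prod; lia|].
    intros p' Hp' (g & HA & HB); pose proof Hp' as [[g2 Hg2] _].
    pose proof (Hdist p Hp); pose proof (Hdist p' Hp').
    destruct (bridged_isometry C _ _ p _ _ p' g (2 * Delta) (HF p Hp) (HF p' Hp'))
      as [H1 H2]; [lra|lra| | |].
    - intros a Ha; apply HA; now exists a.
    - intros b Hb; apply HB; now exists b.
    - apply in_map_iff; exists (g, mul (inv (mul g g1)) g2); simpl; split.
      + now rewrite mulVK.
      + apply in_prod; apply HS; [exact H1|].
        rewrite actM, dist_sym, dist_act_inv, actM, dist_sym, <- Hg1, <- Hg2; exact H2. }
  rewrite Forall_forall in Hl.
  exists (length (map F l')); split.
  - exists (map F l'); split; [reflexivity|split].
    + apply Forall_forall; intros q Hq; apply in_map_iff in Hq as (p & <- & Hp).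
      specialize (Hl p (Hincl p Hp)); pose proof (Hdist p Hl).
      destruct (bridged_setdist C _ _ p (HF p Hl)) as [Hlo Hhi]; [lra|].
      split; eapply Rbar_le_trans; [|exact Hlo|exact Hhi|]; simpl; lra.
    + clear - Hsparse; induction Hsparse as [|p l Hp _ IH]; simpl; constructor; [|exact IH].
      rewrite Forall_forall in *; intros q Hq; apply in_map_iff in Hq as (p' & <- & Hp').
      now apply Hp.
  - rewrite length_map; apply (Rmult_le_reg_l (INR (M + 1))); [exact HM|].
    rewrite <- Rmult_assoc, Rinv_r, Rmult_1_l, <- mult_INR by lra.
    now apply le_INR.
Qed.
End Hyperbolic_action.

Theorem theorem4p2
  (X : Type) (d : X -> X -> R) (G : Type) (mul : G -> G -> G) (one : G) (inv : G -> G)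
  (act : G -> X -> X) (o : X) (h k : G) (H K : G -> Prop) (alpha beta : X -> Prop) :
  is_metric d -> proper_space d -> geodesic_space d -> hyperbolic d ->
  is_group mul one inv -> isometric_action d mul one act -> proper_action d act ->
  non_elementary d act o ->
  loxodromic d mul one inv act o h -> loxodromic d mul one inv act o k ->
  is_max_elementary mul one inv h H -> is_max_elementary mul one inv k K ->
  quasi_geodesic d alpha -> quasi_geodesic d beta ->
  preserves act H alpha -> cocompact d act H alpha ->
  preserves act K beta -> cocompact d act K beta ->
  forall Delta, 0 < Delta ->
  exists Delta' c, 0 < Delta' /\ 0 < c /\
    exists N, forall n, N <= n ->
      card_ge_scaled (arc_rep d act alpha beta n Delta') (same_orbit act alpha beta)
                     c (annulus d act o n Delta) eq.
Proof.
  intros Hmet _ _ (delta & Hd0 & Hyp) Hgrp Hiso Hprop Hne Hloxh Hloxk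
    (Hh & HvcH & _) (Kk & HvcK & _) (ga & _ & _ & _ & _ & _ & Hga) (gb & _ & _ & _ & _ & _ & Hgb)
    _ HcoA _ HcoB Delta HDelta.
  (* The point [ga 0] witnesses that [alpha] is nonempty. *)
  destruct (cocompact_transverse_translate X d G mul one inv act o delta Hmet Hd0 Hyp Hgrp Hiso Hprop
    H h alpha (ga 0)) as [C1 HC1]; auto; [apply Hga; now exists 0|].
  destruct (cocompact_transverse_translate X d G mul one inv act o delta Hmet Hd0 Hyp Hgrp Hiso Hprop
    K k beta (gb 0)) as [C2 HC2]; auto; [apply Hgb; now exists 0|].
  eapply (arcs_ge_annulus X d G mul one inv act o delta); eauto.
  eapply exists_bridged; eauto.
Qed.
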